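(* Let $A\subseteq \mathbb{R}$. If $|\mathbb{R}\setminus A|\leq \aleph_0$, then $C_p(H(A))$ is Lindelöf.
   Context: For $A\subseteq\mathbb{R}$, the Hattori space $H(A)$ is the set $\mathbb{R}$ with the topology $\tau(A)$ in which a point $x\in A$ has the local base $\{(x-\varepsilon,x+\varepsilon) : \varepsilon>0\}$ and a point $x\in\mathbb{R}\setminus A$ has the local base $\{[x,x+\varepsilon) : \varepsilon>0\}$. $C_p(X)$ is the space of continuous real-valued functions on $X$ with the topology of pointwise convergence. *)

(* Defs.v *)
From HB Require Import structures.
From mathcomp Require Import all_boot all_order all_algebra.
From mathcomp Require Import all_classical all_reals all_analysis.
Import Order.TTheory GRing.Theory Num.Theory.
Import numFieldNormedType.Exports.

Set Implicit Arguments.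
Unset Strict Implicit.
Unset Printing Implicit Defensive.

Local Open Scope classical_set_scope.
Local Open Scope ring_scope.

(* The index [A] is phantom in the carrier, which is [R]; it only selects the
   topology. *)
Definition hattori (R : realType) (A : set R) : Type := R.

HB.instance Definition _ (R : realType) (A : set R) :=
  Choice.copy (hattori A) R.

Section HattoriTopology.
Context {R : realType} (A : set R).

Definition hattori_base (x e : R) : set R :=
  if x \in A then `]x - e, x + e[%classic else `[x, x + e[%classic.

Definition hattori_nbhs (x : hattori A) : set_system (hattori A) :=
  filter_from [set e : R | 0 < e] (hattori_base x).

Lemma hattori_base_center (x e : R) : 0 < e -> hattori_base x e x.
Proof.
move=> e0; rewrite /hattori_base; case: ifP => _ /=; rewrite in_itv /=.
  by rewrite ltrBlDr !ltrDl e0.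
by rewrite lexx ltrDl e0.
Qed.

Lemma hattori_base_sub (x d e : R) :
  d <= e -> hattori_base x d `<=` hattori_base x e.
Proof.
move=> de y; rewrite /hattori_base; case: ifP => _ /=;
  rewrite !in_itv /= => /andP[h1 h2]; apply/andP; split => //.
- by apply: le_lt_trans h1; rewrite lerB.
- by apply: lt_le_trans h2 _; rewrite lerD2l.
- by apply: lt_le_trans h2 _; rewrite lerD2l.
Qed.

Lemma hattori_nbhs_filter (x : hattori A) : ProperFilter (hattori_nbhs x).
Proof.
apply: filter_from_proper; last first.
  by move=> e /= e0; exists x; exact: hattori_base_center.
apply: filter_from_filter; first by exists 1; exact: ltr01.
move=> d e /= d0 e0; exists (Num.min d e); first by rewrite /= lt_min d0.
by move=> y yB; split; apply: hattori_base_sub yB; rewrite ge_min lexx ?orbT.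
Qed.

Lemma hattori_nbhs_singleton (x : hattori A) (U : set (hattori A)) :
  hattori_nbhs x U -> U x.
Proof. by move=> [e e0]; apply; exact: hattori_base_center. Qed.

Lemma hattori_base_open (x e y : R) : hattori_base x e y ->
  exists2 d : R, 0 < d & hattori_base y d `<=` hattori_base x e.
Proof.
have [->|yx] := eqVneq y x.
  move=> xB; exists e => //; move: xB; rewrite /hattori_base.
  by case: ifP => _ /=; rewrite in_itv /= => /andP[]; rewrite ltrDl.
move=> yB.
have [l [lB ly]] : exists l : R,
    (forall z, l < z -> z < x + e -> hattori_base x e z) /\ l < y.
  move: yB; rewrite /hattori_base; case: ifP => _ /=.
    rewrite in_itv /= => /andP[h1 _]; exists (x - e); split => // z h3 h4.
    by rewrite /= in_itv /= h3.
  rewrite in_itv /= => /andP[h1 _]; exists x; split.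
    by move=> z h3 h4; rewrite /= in_itv /= h4 ltW.
  by rewrite lt_neqAle eq_sym yx.
have yu : y < x + e.
  by move: yB; rewrite /hattori_base; case: ifP => _ /=;
    rewrite in_itv /= => /andP[].
exists (Num.min (y - l) (x + e - y)); first by rewrite lt_min !subr_gt0 ly.
move=> z zB.
have zu : z < y + Num.min (y - l) (x + e - y).
  by move: zB; rewrite /hattori_base; case: ifP => _ /=;
    rewrite in_itv /= => /andP[].
have zl : y - Num.min (y - l) (x + e - y) < z.
  move: zB; rewrite /hattori_base; case: ifP => _ /=;
    rewrite in_itv /= => /andP[// h _].
  by apply: lt_le_trans h; rewrite gtrBl lt_min !subr_gt0 ly.
apply: lB.
  apply: le_lt_trans zl; rewrite lerBrDl -lerBrDr.
  by rewrite ge_min lexx.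
by apply: lt_le_trans zu _; rewrite -lerBrDl ge_min lexx orbT.
Qed.

Lemma hattori_nbhs_nbhs (x : hattori A) (U : set (hattori A)) :
  hattori_nbhs x U -> hattori_nbhs x (hattori_nbhs^~ U).
Proof.
move=> [e e0 eU]; exists e => // y /hattori_base_open[d d0 dB].
by exists d => // z /dB /eU.
Qed.

HB.instance Definition _ := hasNbhs.Build (hattori A) hattori_nbhs.

HB.instance Definition _ := Nbhs_isNbhsTopological.Build (hattori A)
  hattori_nbhs_filter hattori_nbhs_singleton hattori_nbhs_nbhs.

End HattoriTopology.

(* The subspace topology on [set_type] induced by the product topology. *)
Definition Cp (R : realType) (X : topologicalType) : topologicalType :=
  set_type [set f : {ptws X -> R} | continuous (f : X -> R)].

Definition lindelof (T : topologicalType) : Prop :=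
  forall U : set (set T), (forall V, U V -> open V) ->
    \bigcup_(V in U) V = setT ->
  exists U0 : set (set T),
    [/\ U0 `<=` U, countable U0 & \bigcup_(V in U0) V = setT].

(* Main.v *)
(** A family [N] of (not necessarily open) sets is a network of a space when
    every neighbourhood of every point [x] contains a member of [N] that
    contains [x].  A space with a countable network is Lindelöf.  If [X] has a
    countable network and [Y] a countable base, then the space of continuous
    maps from [X] to [Y] with the pointwise topology has a countable network:
    the sets of maps sending each of finitely many members of the network of
    [X] into a prescribed member of the base of [Y].  Finally, the rational
    open intervals together with the singletons of the countable set of
    Sorgenfrey points form a network of the Hattori space. *)
Require Import Defs.
From mathcomp Require Import all_boot all_order all_algebra.
From mathcomp Require Import all_classical all_reals all_analysis.
Import Order.TTheory GRing.Theory Num.Theory.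
Import numFieldNormedType.Exports.

Set Implicit Arguments.
Unset Strict Implicit.
Unset Printing Implicit Defensive.

Local Open Scope classical_set_scope.
Local Open Scope ring_scope.

Definition network (T : topologicalType) (I : Type) (N : I -> set T) : Prop :=
  forall x V, nbhs x V -> exists2 i, N i x & N i `<=` V.

(** For each network member lying inside some member of [U], one such member of [U] is chosen;
    countably many choices already cover. *)
Lemma network_lindelof (T : topologicalType) (I : countType) (N : I -> set T) :
  network N -> lindelof T.
Proof.
move=> netN U openU coverU.
pose D := [set i | exists2 V, U V & N i `<=` V].
have /choice[c cP] i : exists V, D i -> U V /\ N i `<=` V.
  have [[V UV NV]|nD] := pselect (D i); first by exists V.
  (* [set0] is a mere default: indices outside [D] do not enter the subcover. *)
  by exists set0 => /nD.
exists (c @` D); split.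
- by move=> _ [i /cP[Uc _] <-].
- exact: sub_countable (card_image_le _ _) (countableP _).
- rewrite -subTset => x _.
  have [V UV Vx] : (\bigcup_(V in U) V) x by rewrite coverU.
  have [|i Nx NV] := netN x V.
    by apply: open_nbhs_nbhs; split => //; exact: openU.
  have Di : D i by exists V.
  by exists (c i); [exists i|have [_] := cP _ Di; exact].
Qed.

Definition map_network (X Y : Type) (I J : eqType) (N : I -> set X)
    (M : J -> set Y) (s : seq (I * J)) : set (X -> Y) :=
  [set f | {in s, forall p, N p.1 `<=` f @^-1` M p.2}].

Lemma map_network_nbhs (X Y : topologicalType) (I J : eqType)
    (N : I -> set X) (M : J -> set Y) (f : X -> Y) (V : set {ptws X -> Y}) :
  network N -> (forall j, open (M j)) -> network M -> continuous f ->
  nbhs (f : {ptws X -> Y}) V ->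
  exists2 s, map_network N M s f & map_network N M s `<=` V.
Proof.
move=> netN openM netM cf.
(* The conclusion says that [V] belongs to [F], so it suffices that [F] converges to [f]. *)
pose F := filter_from [set s | map_network N M s f] (map_network N M).
have FF : Filter F.
  apply: filter_from_filter; first by exists [::].
  move=> s t fs ft; exists (s ++ t).
    by move=> p; rewrite mem_cat => /orP[/fs|/ft].
  by move=> g gst; split=> p ps; apply: gst; rewrite mem_cat ps ?orbT.
suff : F --> (f : {ptws X -> Y}) by apply.
(* Convergence is tested on the evaluation at each [x], which is onto thanks to constant maps. *)
apply/cvg_sup => x; apply/cvg_image.
  by rewrite eqEsubset; split=> y // _; exists (cst y).
move=> W /= Wfx.
have [j Mj MW] := netM _ _ Wfx.
have [|i Nx NM] := netN x (f @^-1` M j).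
  by apply: cf; apply: open_nbhs_nbhs.
exists ((fun g : X -> Y => g x) @^-1` W); last first.
  by rewrite image_preimage // eqEsubset; split=> y // _; exists (cst y).
(* A single coordinate needs a single constraint. *)
exists [:: (i, j)]; first by move=> p; rewrite inE => /eqP ->.
by move=> g /(_ (i, j)); rewrite inE eqxx => /(_ isT) gM; exact/MW/gM.
Qed.

Definition rat_itv (R : realType) (p : rat * rat) : set R :=
  `]ratr p.1, ratr p.2[%classic.
Arguments rat_itv : clear implicits.

Lemma rat_itv_sub_ball (R : realType) (x e : R) : 0 < e ->
  exists2 p, rat_itv R p x & rat_itv R p `<=` `]x - e, x + e[%classic.
Proof.
move=> e0.
have /rat_in_itvoo[a] : x - e < x by rewrite ltrBlDr ltrDl.
have /rat_in_itvoo[b] : x < x + e by rewrite ltrDl.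
rewrite !in_itv /= => /andP[xb be] /andP[ea ax].
exists (a, b); rewrite /rat_itv /= ?in_itv /= ?ax //.
by apply: subset_itv; rewrite bnd_simp ltW.
Qed.

Lemma network_rat_itv (R : realType) : network (rat_itv R).
Proof.
move=> x V /nbhs_ballP[e /= e0 eV].
have [p px pe] := rat_itv_sub_ball x e0.
by exists p => //; apply: subset_trans pe _; rewrite -ball_itv.
Qed.

Lemma lindelof_Cp (R : realType) (X : topologicalType) (I : countType)
    (N : I -> set X) : network N -> lindelof (Cp R X).
Proof.
move=> netN.
pose P (s : seq (I * (rat * rat))) : set (Cp R X) :=
  [set f | map_network N (rat_itv R) s (\val f)].
apply: (@network_lindelof _ _ P) => f V.
(* A neighbourhood in the subspace contains the trace of an open [W] of the product. *)
move=> [_ [[W oW <-] /= Wf WV]].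
have cf : continuous (\val f : X -> R) by have := set_valP f.
have [|s sf sW] := map_network_nbhs netN _ (@network_rat_itv R) cf
  (open_nbhs_nbhs (conj oW Wf)).
  by move=> p; exact: interval_open.
by exists s => // g /sW /WV.
Qed.

Lemma network_hattori (R : realType) (A : set R) : countable (~` A) ->
  exists N : rat * rat + nat -> set (hattori A), network N.
Proof.
move=> /countable_injP[g ginj].
exists (fun i => match i with
  | inl p => rat_itv R p
  | inr n => [set x | ~ A x /\ g x = n]
  end) => x V [e /= e0 eV].
have [Ax|nAx] := pselect (A x).
  have [p px pe] := rat_itv_sub_ball x e0.
  exists (inl p) => // y /pe ye; apply: eV.
  by rewrite /hattori_base mem_set.
exists (inr (g x)) => // y [nAy gyx].
have -> : y = x by apply: ginj; rewrite ?inE.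
by apply: eV; exact: hattori_base_center.
Qed.

Theorem theorem7 (R : realType) (A : set R) :
  countable (~` A) -> lindelof (Cp R (hattori A)).
Proof. by move=> /network_hattori[N]; exact: lindelof_Cp. Qed.
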